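(* Let $L/K$ be a degree $2$ Galois extension of fields with Galois group generated by $\sigma$. Assume that $\langle\ ,\ \rangle$ is definite up to $2$, and let $M\in M_{2,2}(L)$ have two different eigenvalues, both in $L$. Assume either that $\Delta_2=\Delta$ or that $M$ has at least one eigenvector $u\in L^2$ with $\langle u,u\rangle\in\Delta$. Then $\mathrm{Num}(M)$ is either, up to an affine transformation of $L$, a $\Delta$-ellipse with two foci (i.e. there are $e,f\in L$ with $f\ne 0$ such that $(\mathrm{Num}(M)-e)/f$ is a $\Delta$-ellipse with two foci), or the $\Delta$-convex hull of the two eigenvalues of $M$.
   Context: For $u,v\in L^n$ set $\langle u,v\rangle:=\sum_{i=1}^n\sigma(u_i)v_i$. The form $\langle\ ,\ \rangle$ is definite up to $n$ if $\langle u,u\rangle\ne 0$ for all $u\in L^n\setminus\{0\}$. The numerical range of an $n\times n$ matrix $M$ over $L$ is $\mathrm{Num}(M):=\{\langle u,Mu\rangle \mid u\in L^n,\ \langle u,u\rangle=1\}\subseteq L$. $\Delta:=\{a\sigma(a)\mid a\in L\}\subseteq K$, $1-\Delta:=\{1-s\mid s\in\Delta\}$, and $\Delta_2$ is the set of sums of two elements of $\Delta$. The $\Delta$-convex hull of $\{a,b\}$, $a\ne b$ in $L$, is $\{ta+(1-t)b\mid t\in\Delta\cap(1-\Delta)\}$. A $\Delta$-ellipse with two foci is a subset of $L$ of the form $\{d_1y\sigma(x)+d_2y\sigma(y)\mid (x,y)\in L^2,\ \delta_1x\sigma(x)+\delta_2y\sigma(y)=1\}$ for some $\delta_1,\delta_2\in\Delta\setminus\{0\}$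 and $d_1,d_2\in L\setminus\{0\}$. *)

(* Defs.v *)
From mathcomp Require Import all_boot all_order all_fingroup all_algebra all_field.
From mathcomp Require Import boolp classical_sets.
Set Implicit Arguments.
Unset Strict Implicit.
Unset Printing Implicit Defensive.
Import GRing.Theory.
Local Open Scope classical_set_scope.
Local Open Scope ring_scope.

(* [s] is meant to be the nontrivial automorphism of a quadratic extension;
   vectors are columns, so that a matrix [M] acts by [u |-> M *m u]. *)

Definition hform (L : fieldType) (s : L -> L) (n : nat) (u v : 'cV[L]_n) : L :=
  \sum_(i < n) s (u i 0) * v i 0.

Definition definite_up_to (L : fieldType) (s : L -> L) (n : nat) : Prop :=
  forall u : 'cV[L]_n, u != 0 -> hform s u u != 0.

Definition num_range (L : fieldType) (s : L -> L) (n : nat) (M : 'M[L]_n) :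
    set L :=
  [set hform s u (M *m u) | u in [set u : 'cV[L]_n | hform s u u = 1]].

Definition Delta (L : fieldType) (s : L -> L) : set L :=
  [set a * s a | a in [set: L]].

Definition Delta2 (L : fieldType) (s : L -> L) : set L :=
  [set a + b | a in Delta s & b in Delta s].

Definition one_minus_Delta (L : fieldType) (s : L -> L) : set L :=
  [set 1 - t | t in Delta s].

Definition Delta_conv (L : fieldType) (s : L -> L) (a b : L) : set L :=
  [set t * a + (1 - t) * b | t in Delta s `&` one_minus_Delta s].

Definition Delta_ellipse (L : fieldType) (s : L -> L) (E : set L) : Prop :=
  exists delta1 delta2 d1 d2 : L,
    [/\ Delta s delta1 /\ delta1 != 0, Delta s delta2 /\ delta2 != 0,
        d1 != 0, d2 != 0
      & E = [set d1 * xy.2 * s xy.1 + d2 * xy.2 * s xy.2 | xy in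
              [set xy : L * L |
                delta1 * (xy.1 * s xy.1) + delta2 * (xy.2 * s xy.2) = 1]]].

Definition eigenvector (L : fieldType) (n : nat) (M : 'M[L]_n) (u : 'cV[L]_n) :
    Prop :=
  u != 0 /\ exists c : L, M *m u = c *: u.

(* The library's [eigenvalue] is defined by row vectors acting on the left of
   [M]; it agrees with the column convention used here. *)
Lemma eigenvalue_colP (L : fieldType) (n : nat) (M : 'M[L]_n) (c : L) :
  reflect (exists2 u : 'cV[L]_n, M *m u = c *: u & u != 0) (eigenvalue M c).
Proof.
have -> : eigenvalue M c = eigenvalue M^T c.
  rewrite !eigenvalue_root_char; congr (root _ c).
  rewrite /char_poly -det_tr; congr (\det _).
  by apply/matrixP => i j; rewrite !mxE eq_sym.
apply: (iffP eigenvalueP) => [[v Mv v0]|[u Mu u0]].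
- exists v^T; last by rewrite trmx_eq0.
  by rewrite -[M]trmxK -trmx_mul Mv linearZ.
- exists u^T; last by rewrite trmx_eq0.
  by rewrite -trmx_mul Mu linearZ.
Qed.

(* Main.v *)
Require Import Defs.
From mathcomp Require Import all_boot all_order all_fingroup all_algebra all_field.
From mathcomp Require Import boolp classical_sets.
From mathcomp Require Import ring.
Import GRing.Theory.
Local Open Scope classical_set_scope.
Local Open Scope ring_scope.

(* If <u,u> = N(c) for an eigenvector u, then u / c is a unit eigenvector, and
   the vector w = (- s u_2, s u_1) completes it to an orthonormal basis.  In
   this basis M is upper triangular, with diagonal a, b and corner d, so
   Num(M) = {a N(x) + d y s(x) + b N(y) | N(x) + N(y) = 1}.  This is the
   convex hull of a and b when d = 0; otherwise, substituting N(x) = 1 - N(y),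
   it is the translate by a of an ellipse with d1 = d and d2 = b - a. *)

Section HermitianForm.

Set Implicit Arguments.
Unset Strict Implicit.

Variables (L : fieldType) (s : {rmorphism L -> L}).

Lemma hformDr n (u v w : 'cV[L]_n) :
  hform s u (v + w) = hform s u v + hform s u w.
Proof. by rewrite -big_split; apply: eq_bigr => i _; rewrite mxE mulrDr. Qed.

Lemma hformZr n a (u v : 'cV[L]_n) : hform s u (a *: v) = a * hform s u v.
Proof. by rewrite mulr_sumr; apply: eq_bigr => i _; rewrite mxE mulrCA. Qed.

Lemma hformDl n (u v w : 'cV[L]_n) :
  hform s (u + v) w = hform s u w + hform s v w.
Proof.
by rewrite -big_split; apply: eq_bigr => i _; rewrite mxE rmorphD mulrDl.
Qed.

Lemma hformZl n a (u v : 'cV[L]_n) : hform s (a *: u) v = s a * hform s u v.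
Proof.
by rewrite mulr_sumr; apply: eq_bigr => i _; rewrite mxE rmorphM mulrA.
Qed.

Lemma hform2E (u v : 'cV[L]_2) :
  hform s u v = s (u 0 0) * v 0 0 + s (u 1 0) * v 1 0.
Proof.
rewrite /hform !big_ord_recl big_ord0 addr0 (_ : lift _ _ = 1) //.
exact: val_inj.
Qed.

Lemma cV2P (u v : 'cV[L]_2) : u 0 0 = v 0 0 -> u 1 0 = v 1 0 -> u = v.
Proof.
move=> h0 h1; apply/colP => i; case: (unliftP 0 i) => [j|] -> //.
by rewrite (ord1 j) (_ : lift _ _ = 1) //; apply/val_inj.
Qed.

(** Both orthogonality relations are listed because deriving one from the other takes [s]
    involutive. The last clause encodes spanning directly as the coordinate formula used below. *)
Definition orthonormal2 (u w : 'cV[L]_2) : Prop :=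
  [/\ hform s u u = 1, hform s u w = 0, hform s w u = 0, hform s w w = 1
    & forall p, p = hform s u p *: u + hform s w p *: w].

Lemma hform_orthonormal2 (u w : 'cV[L]_2) x y z t :
    orthonormal2 u w ->
  hform s (x *: u + y *: w) (z *: u + t *: w) = s x * z + s y * t.
Proof.
case=> uu uw wu ww _.
by rewrite hformDr !hformDl !hformZr !hformZl uu uw wu ww; ring.
Qed.

Hypothesis sK : involutive s.

Lemma unit_vector_orthonormal2 (u : 'cV[L]_2) :
  hform s u u = 1 -> exists w, orthonormal2 u w.
Proof.
move=> u1; have u1E := u1; rewrite hform2E in u1E.
exists (\col_i (if i == 0 then - s (u 1 0) else s (u 0 0))).
split=> //; rewrite ?hform2E ?mxE /= ?rmorphN ?sK; try ring.
  by rewrite -u1E; ring.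
(* Each coordinate of [p] is multiplied by [hform s u u = 1]; the expansion is then a polynomial
   identity. *)
move=> p; apply: cV2P; rewrite !hform2E !mxE /= !rmorphN !sK;
  by rewrite -[LHS]mulr1 -u1E; ring.
Qed.

Lemma hform_normalize n (u : 'cV[L]_n) :
    hform s u u != 0 -> Delta s (hform s u u) ->
  exists c, hform s (c *: u) (c *: u) = 1.
Proof.
move=> u0 [c _ cE]; move: u0; rewrite -cE mulf_eq0 negb_or => /andP[c0 sc0].
by exists c^-1; rewrite hformZr hformZl -cE fmorphV; field; apply/andP.
Qed.

(** For an eigenvector [v = x *: u + y *: w], pairing [M *m v = c *: v] with [w] and [u] gives
    [c * y = y * b] and [c * x = x * a + y * d]. Hence [c = b] if [y != 0]; otherwise [x != 0] and
    [c = a]. *)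
Lemma eigenvalue_triangular (M : 'M[L]_2) (u w : 'cV[L]_2) a d b c :
    orthonormal2 u w -> M *m u = a *: u -> M *m w = d *: u + b *: w ->
  eigenvalue M c -> c = a \/ c = b.
Proof.
move=> [uu uw wu ww dec] Mu Mw /eigenvalue_colP[v Mv v0].
set x := hform s u v; set y := hform s w v.
have vE : v = x *: u + y *: w := dec v.
have Mv' : M *m v = (x * a + y * d) *: u + (y * b) *: w.
  rewrite {1}vE mulmxDr -!scalemxAr Mu Mw scalerDr !scalerA addrA.
  by rewrite [in RHS]scalerDl.
have ey : c * y = y * b.
  by rewrite /y -hformZr -Mv Mv' hformDr !hformZr wu ww mulr0 add0r mulr1.
have ex : c * x = x * a + y * d.
  by rewrite {1}/x -hformZr -Mv Mv' hformDr !hformZr uu uw mulr0 addr0 mulr1.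
have [y0|yN0] := eqVneq y 0; last first.
  by right; apply: (mulIf yN0); rewrite ey mulrC.
left; have xN0 : x != 0.
  by apply: contra v0 => /eqP x0; rewrite vE x0 y0 !scale0r addr0.
by apply: (mulIf xN0); rewrite ex y0 mul0r addr0 mulrC.
Qed.

Lemma num_range_triangular (M : 'M[L]_2) (u w : 'cV[L]_2) a d b :
    orthonormal2 u w -> M *m u = a *: u -> M *m w = d *: u + b *: w ->
  num_range s M =
    [set a * (xy.1 * s xy.1) + d * xy.2 * s xy.1 + b * (xy.2 * s xy.2) | xy in
      [set xy : L * L | xy.1 * s xy.1 + xy.2 * s xy.2 = 1]].
Proof.
move=> uwP Mu Mw.
have ME x y : M *m (x *: u + y *: w) = (x * a + y * d) *: u + (y * b) *: w.
  rewrite mulmxDr -!scalemxAr Mu Mw scalerDr !scalerA addrA.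
  by rewrite [in RHS]scalerDl.
apply/seteqP; split=> z.
- case=> p /= p1 <-; have [_ _ _ _ /(_ p) pE] := uwP.
  move: (hform s u p) (hform s w p) pE p1 => x y -> xy1; exists (x, y) => /=.
    by rewrite -xy1 (hform_orthonormal2 _ _ _ _ uwP); ring.
  by rewrite ME (hform_orthonormal2 _ _ _ _ uwP); ring.
- case=> -[x y] /= xy1 <-; exists (x *: u + y *: w) => /=.
    by rewrite (hform_orthonormal2 _ _ _ _ uwP) -xy1; ring.
  by rewrite ME (hform_orthonormal2 _ _ _ _ uwP); ring.
Qed.

End HermitianForm.

Lemma Delta_convC (L : fieldType) (s : L -> L) (a b : L) :
  Delta_conv s a b = Delta_conv s b a.
Proof.
suff sub x y : Delta_conv s x y `<=` Delta_conv s y x.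
  by apply/seteqP; split; apply: sub.
(* The map [t |-> 1 - t] exchanges [Delta s] and [one_minus_Delta s]. *)
move=> _ [t [Dt [r Dr rE]] <-]; exists (1 - t); last by ring.
by split; [rewrite -rE subKr | exists t].
Qed.

(** A parameter [t] is admissible exactly when [t = x * s x] and [1 - t = y * s y] for some [x],
    [y], that is, when it comes from a point of the unit circle. *)
Lemma Delta_convE (L : fieldType) (s : L -> L) (a b : L) :
  Delta_conv s a b = [set a * (xy.1 * s xy.1) + b * (xy.2 * s xy.2) | xy in
      [set xy : L * L | xy.1 * s xy.1 + xy.2 * s xy.2 = 1]].
Proof.
apply/seteqP; split=> z.
- case=> t [[x _ xE] [r [y _ yE] rE]] <-; exists (x, y) => /=.
    by rewrite xE yE -rE subrK.
  by rewrite xE yE -rE; ring.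
- case=> -[x y] /= xy1 <-; have yE : y * s y = 1 - x * s x.
    by rewrite -xy1 addrC addKr.
  exists (x * s x); last by rewrite yE; ring.
  split; first by exists x.
  by exists (y * s y); [exists y | rewrite yE subKr].
Qed.

Lemma triangular_Delta_ellipse (L : fieldType) (s : {rmorphism L -> L})
    (a b d : L) :
    d != 0 -> a != b ->
  Delta_ellipse s [set (z - a) / 1 | z in
    [set a * (xy.1 * s xy.1) + d * xy.2 * s xy.1 + b * (xy.2 * s xy.2) | xy in
      [set xy : L * L | xy.1 * s xy.1 + xy.2 * s xy.2 = 1]]].
Proof.
move=> d0 ab; exists 1, 1, d, (b - a).
have D1 : Delta s 1 /\ 1 != 0 :> L.
  by rewrite oner_neq0; split=> //; exists 1; rewrite // rmorph1 mulr1.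
split=> //; first by rewrite subr_eq0 eq_sym.
have E x y : x * s x + y * s y = 1 ->
    a * (x * s x) + d * y * s x + b * (y * s y) - a
      = d * y * s x + (b - a) * y * s y.
  (* The subtracted [a] becomes [a * (x * s x + y * s y)], which cancels the [x * s x] term. *)
  by move=> xy1; rewrite -[X in _ - X]mulr1 -xy1; ring.
rewrite image_comp; apply/seteqP; split=> z [[x y] /= xy1 <-];
  exists (x, y); rewrite /= ?mul1r ?divr1 ?E //; by rewrite !mul1r in xy1.
Qed.

(** The order of the generator [sigma] is that of the Galois group, hence the degree 2. *)
Lemma gal_dim2_involutive (K : fieldType) (L : splittingFieldType K)
    (sigma : gal_of {:L}) :
    \dim {:L} = 2%N -> galois 1 {:L} -> 'Gal({:L} / 1)%g = <[sigma]>%g ->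
  involutive sigma.
Proof.
move=> dimL galL genL x.
have o2 : #[sigma]%g = 2%N.
  by rewrite orderE -genL -(galois_dim galL) dimL dimv1 divn1.
have sL : sigma x \in {:L}%VS by rewrite memvf.
by rewrite -galM ?memvf // -expg2 -o2 expg_order gal_id.
Qed.

Theorem proposition4 (K : fieldType) (L : splittingFieldType K)
    (dimL : \dim {:L} = 2%N) (galL : galois 1 {:L})
    (sigma : gal_of {:L}) (genL : 'Gal({:L} / 1)%g = <[sigma]>%g)
    (hdef : definite_up_to sigma 2)
    (M : 'M[L]_2) (c1 c2 : L)
    (hc1 : eigenvalue M c1) (hc2 : eigenvalue M c2) (hc : c1 <> c2)
    (hM : Delta2 sigma = Delta sigma \/
          exists u : 'cV[L]_2, eigenvector M u /\ Delta sigma (hform sigma u u)) :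
  (exists e f : L,
     f <> 0 /\ Delta_ellipse sigma [set (z - e) / f | z in num_range sigma M]) \/
  num_range sigma M = Delta_conv sigma c1 c2.
Proof.
have sK : involutive sigma by exact: gal_dim2_involutive.
have {hM} [u [[u0 [a Mu]] Du]] :
    exists u : 'cV[L]_2, eigenvector M u /\ Delta sigma (hform sigma u u).
  (* If [Delta2 sigma = Delta sigma], any eigenvector will do, since [hform sigma u u] is a sum of
     two norms. *)
  case: hM => // D2; have /eigenvalue_colP[u Mu u0] := hc1.
  exists u; split; first by split=> //; exists c1.
  rewrite -D2 hform2E; exists (sigma (u 0 0) * u 0 0).
    by exists (u 0 0); rewrite // mulrC.
  exists (sigma (u 1 0) * u 1 0) => //.
  by exists (u 1 0); rewrite // mulrC.
have [k ku1] := hform_normalize (hdef u u0) Du.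
have Mku : M *m (k *: u) = a *: (k *: u).
  by rewrite -scalemxAr Mu !scalerA mulrC.
have [w uwP] := unit_vector_orthonormal2 sK ku1.
have [_ _ _ _ /(_ (M *m w)) Mw] := uwP.
move: {Mw}(hform _ _ _) (hform _ w _) Mw => d b Mw.
(* As [c1] and [c2] are distinct and both lie among [a] and [b], they are [a] and [b] in some
   order. *)
have a12 := eigenvalue_triangular uwP Mku Mw hc1.
have b12 := eigenvalue_triangular uwP Mku Mw hc2.
have NumE := num_range_triangular uwP Mku Mw.
have [d0|d0] := eqVneq d 0.
  right; have -> : num_range sigma M = Delta_conv sigma a b.
    rewrite NumE Delta_convE d0; apply: eq_imagel => xy _.
    by rewrite !mul0r addr0.
  (* Equal choices contradict [hc]; the swapped order is settled by symmetry of the hull. *)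
  by case: a12 hc b12 => -> hc [] e2; rewrite e2 // in hc *; apply: Delta_convC.
left; exists a, 1; split; first exact/eqP/oner_neq0.
rewrite NumE; apply: triangular_Delta_ellipse => //.
apply/eqP => ab; apply: hc.
by case: a12 b12 => -> [] ->; rewrite ?ab.
Qed.
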